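(* The bundle $(C(\mathbb R,\mathbb R)^\omega,\upsilon,F^C(\mathbb R,\mathbb R)_{\omega Q_{\mathrm{pt}}})$ of continuously represented pointwise extrafunctions has a differentially represented section; that is, there exists a map $r:F^C(\mathbb R,\mathbb R)_{\omega Q_{\mathrm{pt}}}\to C(\mathbb R,\mathbb R)^\omega$ with $\upsilon\circ r=\mathrm{id}$ such that for every $H\in F^C(\mathbb R,\mathbb R)_{\omega Q_{\mathrm{pt}}}$ all the functions in the sequence $r(H)$ are differentiable on $\mathbb R$.
   Context: $F(\mathbb R,\mathbb R)$ is the real vector space of all functions $\mathbb R\to\mathbb R$, and $F(\mathbb R,\mathbb R)^\omega$ the space of sequences of such functions. $Q_{\mathrm{pt}}$ is the set of seminorms $q_{\mathrm{pt}\,x}(f)=|f(x)|$, $x\in\mathbb R$. Two sequences $(f_i),(g_i)$ are equivalent if $\lim_{i\to\infty}q(f_i-g_i)=0$ for all $q\in Q_{\mathrm{pt}}$, i.e. $f_i(x)-g_i(x)\to0$ for every $x\in\mathbb R$. $F(\mathbb R,\mathbb R)_{\omega Q_{\mathrm{pt}}}$ is the set of equivalence classes. $C(\mathbb R,\mathbb R)^\omega$ is the space of all sequences of continuous functions $\mathbb R\to\mathbb R$. An element $H\in F(\mathbb R,\mathbb R)_{\omega Q_{\mathrm{pt}}}$ is continuously represented if it is the class of some sequence in $C(\mathbb R,\mathbb R)^\omega$; $F^C(\mathbb R,\mathbb R)_{\omega Q_{\mathrm{pt}}}$ is the set of all such elements, and $\upsilon:C(\mathbb R,\mathbb R)^\omega\to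 F^C(\mathbb R,\mathbb R)_{\omega Q_{\mathrm{pt}}}$ is the natural projection sending a sequence to its class. A section is a map $r$ with $\upsilon\circ r=\mathrm{id}$ (no further conditions). *)

(* Defs.v *)
From HB Require Import structures.
From mathcomp Require Import all_boot all_order all_algebra generic_quotient.
From mathcomp Require Import all_classical all_reals all_analysis.
Set Implicit Arguments.
Unset Strict Implicit.
Unset Printing Implicit Defensive.
Import Order.TTheory GRing.Theory Num.Theory.
Import numFieldNormedType.Exports.
Local Open Scope classical_set_scope.
Local Open Scope ring_scope.
Local Open Scope quotient_scope.

Definition q_pt (R : realType) (x : R) (f : R -> R) : R := `|f x|.

Definition Q_pt (R : realType) : set ((R -> R) -> R) := range (@q_pt R).

Definition seq_equiv (R : realType) (Q : set ((R -> R) -> R))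
    (f g : nat -> R -> R) : Prop :=
  forall q, Q q -> q (f i - g i) @[i --> \oo] --> (0 : R).

Definition pt_equiv (R : realType) : rel (nat -> R -> R) :=
  fun f g => `[< seq_equiv (@Q_pt R) f g >].

Lemma pt_equiv_refl (R : realType) : reflexive (@pt_equiv R).
Proof.
move=> f; apply/asboolP => _ [x _ <-].
have -> : (fun i => q_pt x (f i - f i)) = fun=> 0.
  by apply/funext => i; rewrite subrr /q_pt normr0.
exact: cvg_cst.
Qed.

Lemma pt_equiv_sym (R : realType) : symmetric (@pt_equiv R).
Proof.
suff h : forall f g : nat -> R -> R, pt_equiv f g -> pt_equiv g f.
  by move=> f g; apply/idP/idP; exact: h.
rewrite /pt_equiv => f g /asboolP fg; apply/asboolP => q Qq.
have := fg q Qq; case: Qq => x _ <-.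
suff -> : (fun i => q_pt x (f i - g i)) = fun i => q_pt x (g i - f i) by [].
by apply/funext => i; exact: distrC.
Qed.

Lemma pt_equiv_trans (R : realType) : transitive (@pt_equiv R).
Proof.
rewrite /pt_equiv => g f h /asboolP fg /asboolP gh; apply/asboolP => q Qq.
have fq := fg q Qq; have gq := gh q Qq; case: Qq fq gq => x _ <- fx gx.
apply: (@squeeze_cvgr _ \oo _ _ (fun=> 0)
  (fun i => q_pt x (f i - g i) + q_pt x (g i - h i))).
- by apply: nearW => i; rewrite normr_ge0; exact: ler_distD.
- exact: cvg_cst.
- by rewrite -[X in _ --> X](addr0 (0 : R)); exact: cvgD.
Qed.

Canonical pt_equiv_rel (R : realType) : equiv_rel (nat -> R -> R) :=
  EquivRel (@pt_equiv R) (@pt_equiv_refl R) (@pt_equiv_sym R)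
    (@pt_equiv_trans R).

Definition pt_extrafunction (R : realType) : Type :=
  {eq_quot @pt_equiv_rel R}.

Definition extra_class (R : realType) (f : nat -> R -> R) :
    pt_extrafunction R :=
  \pi_({eq_quot @pt_equiv_rel R}) f.

Definition cont_seq (R : realType) : Type := nat -> continuousType R R.

Definition cont_represented (R : realType) : set (pt_extrafunction R) :=
  [set H | exists f : cont_seq R, extra_class (fun i => f i : R -> R) = H].

Lemma extra_class_cont (R : realType) (f : cont_seq R) :
  cont_represented (extra_class (fun i => f i : R -> R)).
Proof. by exists f. Qed.

Definition cont_extrafunction (R : realType) : Type :=
  {H : pt_extrafunction R | cont_represented H}.

Definition upsilon (R : realType) (f : cont_seq R) : cont_extrafunction R :=
  exist _ (extra_class (fun i => f i : R -> R)) (extra_class_cont f).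

Definition is_section (E B : Type) (p : E -> B) (r : B -> E) : Prop :=
  p \o r = id.

Definition differentially_represented (R : realType)
    (r : cont_extrafunction R -> cont_seq R) : Prop :=
  forall (H : cont_extrafunction R) (i : nat) (x : R),
    derivable (r H i : R -> R) x 1.

(* Main.v *)
(* If F is a primitive of a continuous f, the difference quotient
   (F (x + h) - F x) / h is differentiable in x and, by the mean value theorem,
   equals f c for some x < c < x + h; by uniform continuity it therefore tends
   to f uniformly on compact sets as h tends to 0.  Replacing the i-th function
   of a sequence by such a quotient, within 1 / (i + 1) of it on [-i, i],
   preserves the pointwise class; the section is then given by choice. *)

Require Import Defs.
From mathcomp Require Import all_boot all_order all_algebra ring lra.
From mathcomp Require Import generic_quotient.
From mathcomp Require Import all_classical all_reals all_analysis.

Set Implicit Arguments.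
Unset Strict Implicit.
Unset Printing Implicit Defensive.

Import Order.TTheory GRing.Theory Num.Theory.
Import numFieldNormedType.Exports.
Local Open Scope classical_set_scope.
Local Open Scope ring_scope.

(** An integral over [[b, x]] is 0, not negatively signed, when [x < b], so it can be a primitive on
    the whole line only if [f] vanishes there. Left of [a] the integral is locally 0; from [a] on,
    the fundamental theorem of calculus applies. *)
Lemma primitive_of_vanishing_left (R : realType) (f : R -> R) (a : R) :
  continuous f -> (forall x, x <= a -> f x = 0) ->
  exists F : R -> R, forall x : R, is_derive x 1 F (f x).
Proof.
move=> cf f0; pose mu := @lebesgue_measure R.
(* Starting at [a - 1] puts [x = a] strictly to the right of the base point, as the fundamental
   theorem requires. *)
pose F x : R := (\int[mu]_(t in `[(a - 1)%R, x]) f t)%R.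
exists F => x.
have [xa|ax] := ltP x a.
  have F0 : \near x, (cst 0 : R -> R) x = F x.
    near=> y; rewrite /F /Rintegral integral0_eq//= => t.
    rewrite /= in_itv/= => /andP[_ ty]; rewrite f0// (le_trans ty)// ltW//.
    by near: y; exact: lt_nbhsl.
  rewrite f0 ?ltW//.
  by apply: near_eq_is_derive F0 _; exact: is_derive_cst.
have [|||Fd <-] := @continuous_FTC1_closed R f (a - 1) x (x + 1) _ _ _ (cf x).
- by rewrite ltrDl.
- apply: continuous_compact_integrable; first exact: segment_compact.
  exact: continuous_subspaceT.
- by rewrite ltrBlDr (le_lt_trans ax)// ltrDl.
by rewrite derive1E; exact/derivableP.
Unshelve. all: by end_near. Qed.

Lemma continuous_has_primitive (R : realType) (f : R -> R) :
  continuous f -> exists F : R -> R, forall x : R, is_derive x 1 F (f x).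
Proof.
move=> cf.
have prim (g : R -> R) : continuous g -> exists F : R -> R,
    forall x : R, is_derive x 1 F (g (Num.max x 0) - g 0).
  move=> cg; apply: (@primitive_of_vanishing_left _ _ 0) => x.
    apply: (@continuousB R R^o R (g \o (id \max cst 0)) (cst (g 0))).
      apply: continuous_comp; last exact: cg.
      by apply: (@continuous_max R R); [exact: cvg_id|exact: cvg_cst].
    exact: cvg_cst.
  by move=> x0; rewrite max_r// subrr.
(* f x = (f (max x 0) - f 0) + (f (min x 0) - f 0) + f 0; the middle term is
   obtained from the first one by reflection. *)
have [A dA] := prim f cf.
have [|B dB] := prim (f \o -%R).
  by move=> x; apply: continuous_comp; [exact: opp_continuous|exact: cf].
exists (A \- (B \o -%R) + (f 0 \*: id)) => x.
have dBx := dB (- x); have dAx := dA x.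
have dBN := @is_derive1_comp _ _ _ _ _ _ dBx (is_deriveNid x 1).
apply: is_derive_eq; rewrite /= oppr0 mulrN1 opprK scaler1.
have [x0|x0] := leP 0 x.
  by rewrite max_r ?oppr_le0// oppr0 subrr addr0 subrK.
by rewrite max_l ?oppr_ge0 1?ltW// opprK subrr add0r subrK.
Qed.

Lemma derivable_approximation (R : realType) (f : R -> R) (K : set R) (e : R) :
  continuous f -> compact K -> 0 < e ->
  exists g : R -> R, (forall x : R, derivable g x 1) /\
    (forall x, K x -> `|g x - f x| < e).
Proof.
move=> cf /compact_near_coveringP cK e0.
have [F dF] := continuous_has_primitive cf.
pose G h x := h^-1 * (F (x + h) - F x).
have dG h x : derivable (G h) x 1.
  have dFx := dF x; have dFxh := dF (x + h).
  have dFh := @is_derive1_comp _ F (fun y => y + h) x _ _ dFxh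
    (is_derive_shift _ _ _).
  exact: ex_derive.
have GE h x : 0 < h -> exists2 c, x < c < x + h & G h x = f c.
  move=> h0; have xh : x < x + h by rewrite ltrDl.
  have [|c] := MVT xh (fun y _ => dF y).
    apply: continuous_subspaceT => y.
    exact/differentiable_continuous/derivable1_diffP/ex_derive.
  rewrite in_itv/= => cxh FE; exists c => //.
  by rewrite /G FE [x + h]addrC addrK mulrCA mulVf ?mulr1// gt_eqF.
(* The near-covering form of compactness makes this local: for each [x] in [K], the bound is needed
   only for [y] near [x] and small [h > 0] jointly. *)
have : \forall h \near 0^'+, K `<=` (fun x => `|G h x - f x| < e).
  apply: cK => x Kx.
  have /cvgrPdist_lt /(_ (e / 2)) := cf x.
  rewrite divr_gt0// => /(_ isT) /nbhs_ballP[/= r r0 fxr].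
  have r20 : 0 < r / 2 by rewrite divr_gt0.
  (* With [y] within [r / 2] of [x] and [h < r / 2], every [c] between [y] and [y + h] is within [r]
     of [x]. *)
  exists (ball x (r / 2), [set h | 0 < h < r / 2]) => /=.
    split; first exact: nbhsx_ballx.
    near=> h; apply/andP; split => //.
  move=> [y h]/= [xy /andP[h0 hr]].
  have [c /andP[yc cyh] ->] := GE h y h0.
  have yr : `|f x - f y| < e / 2.
    apply: fxr; apply: le_ball xy; lra.
  have cr : `|f x - f c| < e / 2.
    apply: fxr; move: xy; rewrite /ball/= !ltr_norml => /andP[? ?].
    by apply/andP; split; lra.
  rewrite (_ : f c - f y = (f x - f y) - (f x - f c)); last by ring.
  by rewrite (splitr e) (le_lt_trans (ler_normB _ _))// ltrD.
move=> /filter_ex[h Kh]; exists (G h); split => //.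
Unshelve. all: by end_near. Qed.

(** A fixed [x] satisfies the side condition for all large [i], and the bound tends to 0. *)
Lemma pt_equiv_of_lt (R : realType) (f g : nat -> R -> R) :
  (forall i x, `|x| <= i%:R -> `|f i x - g i x| < i.+1%:R^-1) ->
  pt_equiv f g.
Proof.
move=> fg; apply/asboolP => _ [x _ <-]; apply/cvgrPdist_lt => e e0.
near=> i; rewrite sub0r normrN /q_pt normr_id.
apply: (lt_trans (fg i x _)).
  by near: i; exact: nbhs_infty_ger.
by near: i; exact: near_infty_natSinv_lt (PosNum e0).
Unshelve. all: by end_near. Qed.

Lemma cont_seq_derivable_equiv (R : realType) (f : cont_seq R) :
  exists g : cont_seq R, pt_equiv (fun i => g i : R -> R) (fun i => f i) /\
    forall i (x : R), derivable (g i : R -> R) x 1.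
Proof.
have fi_approx i : exists g : continuousType R R,
    (forall x : R, derivable (g : R -> R) x 1) /\
    forall x : R, `|x| <= i%:R -> `|g x - f i x| < i.+1%:R^-1.
  have [|||g [dg gf]] := @derivable_approximation R (f i)
      `[- i%:R, i%:R] (i.+1%:R^-1).
  - exact: cts_fun.
  - exact: segment_compact.
  - by rewrite invr_gt0.
  (* Derivability gives the continuity needed to package [g] as a term of [cts]-bundled type, so
     that the new sequence stays in [cont_seq]. *)
  have cg : continuous g.
    by move=> x; apply/differentiable_continuous/derivable1_diffP.
  exists (mkcts cg); split => // x; rewrite ler_norml => xi.
  by apply: gf; rewrite /= in_itv.
have [g gP] := choice fi_approx.
exists g; split; last by move=> i; have [] := gP i.
by apply: pt_equiv_of_lt => i; have [] := gP i.
Qed.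

Theorem theorem3p4 (R : realType) :
  exists r : cont_extrafunction R -> cont_seq R,
    is_section (@upsilon R) r /\ differentially_represented r.
Proof.
have rP (H : cont_extrafunction R) : exists g : cont_seq R,
    upsilon g = H /\ forall i (x : R), derivable (g i : R -> R) x 1.
  case: H => H [f fH]; have [g [gf dg]] := cont_seq_derivable_equiv f.
  (* Proof irrelevance reduces equality in the subtype to equality of classes. *)
  by exists g; split => //; apply: eq_exist; rewrite -fH; exact/eqquotP.
have [r rH] := choice rP.
exists r; split; first by apply/funext => H; have [] := rH H.
by move=> H; have [] := rH H.
Qed.
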